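(* Let $(\Omega,\mathcal F,\mathbb P)$ be an atomless probability space, let $p\in(0,1)$ and let $\rho:L^\infty\to\mathbb R$ be a risk measure satisfying [$p$-CA] and $\rho(0)=0$. (i) $\rho$ is a consistent risk measure if and only if $\rho(X)=g(\mathrm{ES}_p(X)-\mathbb E[X])+\mathbb E[X]$ for all $X\in L^\infty$, for some increasing and $1$-Lipschitz function $g:[0,\infty)\to\mathbb R$ with $g(0)=0$. (ii) $\rho$ is a convex risk measure if and only if $\rho(X)=g(\mathrm{ES}_p(X)-\mathbb E[X])+\mathbb E[X]$ for all $X\in L^\infty$, for some increasing, convex and $1$-Lipschitz function $g:[0,\infty)\to\mathbb R$ with $g(0)=0$. (iii) $\rho$ is a coherent risk measure if and only if $\rho(X)=\alpha\,\mathrm{ES}_p(X)+(1-\alpha)\mathbb E[X]$ for all $X\in L^\infty$, for some $\alpha\in[0,1]$.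
   Context: $(\Omega,\mathcal F,\mathbb P)$ is atomless; $L^\infty$ is the space of essentially bounded random variables. A risk measure is simply a functional on this space. ''Increasing'' means non-strictly increasing; $g$ is $1$-Lipschitz if $|g(x)-g(y)|\le|x-y|$ for all $x,y\ge 0$. $X\overset{d}{=}Y$ means equality in law. For $p\in(0,1)$, $\mathrm{VaR}_p(X)=\inf\{x\in\mathbb R:\mathbb P(X\le x)\ge p\}$ and $\mathrm{ES}_p(X)=\frac1{1-p}\int_p^1\mathrm{VaR}_s(X)\,ds$. A tail event of a random variable $X$ is an event $A\in\mathcal F$ with $0<\mathbb P(A)<1$ such that $X(\omega)\ge X(\omega')$ for a.s. all $\omega\in A$ and $\omega'\in A^c$. A $p$-tail event of $X$ is a tail event of $X$ with probability $1-p$. A random vector is $p$-concentrated if its components share a common $p$-tail event. [$p$-CA]: $\rho(X+Y)\le\rho(X'+Y')$ for all $X,Y,X',Y'\in L^\infty$ such that $(X',Y')$ is $p$-concentrated, $X\overset{d}{=}X'$ and $Y\overset{d}{=}Y'$. A monetary risk measure is one satisfying $\rho(X)\le\rho(Y)$ whenever $X\le Y$ pointwise, and $\rho(X+c)=\rho(X)+c$ for all $c\in\mathbb R$. A consistent risk measure is a monetary risk measure such that $\rho(X)\le\rho(Y)$ whenever $\mathbb E[u(X)]\le\mathbb E[u(Y)]$ for all increasing convex $u:\mathbb R\to\mathbb R$. A convex risk measure is a monetary risk measure such that $\rho(\lambda X+(1-\lambda)Y)\le\lambda\rho(X)+(1-\lambda)\rho(Y)$ for all $X,Y$ and $\lambda\in[0,1]$.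 A coherent risk measure is a convex risk measure with $\rho(\lambda X)=\lambda\rho(X)$ for all $\lambda\in(0,\infty)$ and all $X$. *)

(* Defs.v *)
From HB Require Import structures.
From mathcomp Require Import all_boot all_order all_algebra.
From mathcomp Require Import all_classical all_reals all_analysis.

Set Implicit Arguments.
Unset Strict Implicit.
Unset Printing Implicit Defensive.
Import Order.TTheory GRing.Theory Num.Theory.
Import numFieldNormedType.Exports.

Local Open Scope classical_set_scope.
Local Open Scope ring_scope.

Section Linfty.
Context (d : measure_display) (T : measurableType d) (R : realType).
Variable P : probability T R.

Definition atomless :=
  forall A : set T, measurable A -> (0 < P A)%E ->
    exists B : set T, [/\ measurable B, B `<=` A, (0 < P B)%E & (P B < P A)%E].

(* Elements are genuine functions, not classes modulo almost sure equality;
   the vector space operations are the pointwise ones. *)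
Definition Linfty := LfunType P (leey 1%E).

Lemma Lfun_cst_infty (c : R) : (cst c : T -> R) \in Lfun P +oo.
Proof.
apply/andP; split; first by rewrite inE /=; exact: measurable_cst.
apply: mem_set; rewrite /= /finite_norm unlock /=.
case: ifP => _; last exact: ltry.
apply: (@le_lt_trans _ _ `|c|%:E); last exact: ltry.
by apply: ereal_inf_lbound; apply: nearW => w.
Qed.

Definition cstL (c : R) : Linfty := Lfun_Sub (leey 1%E) (Lfun_cst_infty c).

(* Equality is only tested on measurable sets, since a measure is unspecified
   on the other ones. *)
Definition eq_in_law (X Y : Linfty) :=
  forall B : set R, measurable B -> distribution P X B = distribution P Y B.

Definition mean (X : Linfty) : R := fine 'E_P[X].

Definition VaR (s : R) (X : Linfty) : R :=
  inf [set x : R | (s%:E <= cdf (P := P) X x)%E].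

Definition ES (p : R) (X : Linfty) : R :=
  (1 - p)^-1 * \int[lebesgue_measure]_(s in `]p, 1[) VaR s X.

(* "For a.s. all w in A and w' outside A": for all such w, w' outside of a
   single null set N. *)
Definition tail_event (A : set T) (X : Linfty) :=
  [/\ measurable A, (0 < P A)%E, (P A < 1)%E &
    exists2 N : set T, P.-negligible N &
      forall w w', A w -> ~ A w' -> ~ N w -> ~ N w' -> X w' <= X w].

Definition p_tail_event (p : R) (A : set T) (X : Linfty) :=
  tail_event A X /\ P A = (1 - p)%:E.

Definition p_concentrated (p : R) (X Y : Linfty) :=
  exists A : set T, p_tail_event p A X /\ p_tail_event p A Y.

Definition pCA (p : R) (rho : Linfty -> R) :=
  forall X Y X' Y' : Linfty, p_concentrated p X' Y' ->
    eq_in_law X X' -> eq_in_law Y Y' -> rho (X + Y) <= rho (X' + Y').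

Definition monetary (rho : Linfty -> R) :=
  (forall X Y : Linfty, (forall w, X w <= Y w) -> rho X <= rho Y) /\
  (forall (X : Linfty) (c : R), rho (X + cstL c) = rho X + c).

Definition consistent (rho : Linfty -> R) :=
  monetary rho /\
  forall X Y : Linfty,
    (forall u : R -> R, {homo u : x y / x <= y} ->
       convex_function (setT : set R) u ->
       ('E_P[u \o X] <= 'E_P[u \o Y])%E) ->
    rho X <= rho Y.

Definition convex_risk (rho : Linfty -> R) :=
  monetary rho /\
  forall (X Y : Linfty) (l : R), 0 <= l -> l <= 1 ->
    rho (l *: X + (1 - l) *: Y) <= l * rho X + (1 - l) * rho Y.

Definition coherent (rho : Linfty -> R) :=
  convex_risk rho /\
  forall (X : Linfty) (l : R), 0 < l -> rho (l *: X) = l * rho X.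

End Linfty.

(* The functions g below are defined on [0, +oo[; they are encoded as total
   functions of which only the restriction to [0, +oo[ is constrained. *)
Definition increasing_nonneg (R : realType) (g : R -> R) :=
  forall x y : R, 0 <= x -> x <= y -> g x <= g y.

Definition lipschitz1_nonneg (R : realType) (g : R -> R) :=
  forall x y : R, 0 <= x -> 0 <= y -> `|g x - g y| <= `|x - y|.

(* Main.v *)
Require Import Defs.
From mathcomp Require Import all_boot all_order all_algebra.
From mathcomp Require Import all_classical all_reals all_analysis.
From mathcomp Require Import measurable_realfun ring lra.
Import Order.TTheory GRing.Theory Num.Theory.
Import numFieldNormedType.Exports.
Set Implicit Arguments.
Unset Strict Implicit.
Unset Printing Implicit Defensive.
Local Open Scope classical_set_scope.
Local Open Scope ring_scope.

(* Write E[X; B] for the mean of X over the event B. If A is a p-tail event of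
   X, then (1 - p) ES_p(X) = E[X; A] is the maximum of E[X; B] over the events
   B of probability 1 - p; monotonicity, subadditivity and consistency of ES_p
   with the increasing convex order follow.

   Conversely let rho be monetary with [p-CA]. It is law invariant and
   Lipschitz for the uniform norm, and by [p-CA] rho(c 1_B + W) does not change
   when B is moved inside A (c >= 0), or inside its complement (c <= 0), as
   long as W has tail event A. Cutting c 1_B into N copies of (c/N) 1_B and
   spreading them evenly replaces c 1_B by its average over A as N grows.
   Since X is uniformly approximated by sums of such steps, rho(X) equals rho
   of the variable equal to E[X | A] on A and to E[X | A^c] on A^c, so that
   rho(X) = g(ES_p(X) - E[X]) + E[X] for some g. One more use of [p-CA] shows
   that g is increasing, and translation invariance that it is 1-Lipschitz. *)

(** * Atomless probability spaces *)

Section Sierpinski.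
Context (d : measure_display) (T : measurableType d) (R : realType).
Variable P : probability T R.

Definition prob (A : set T) : R := fine (P A).

Lemma probK A : measurable A -> (prob A)%:E = P A.
Proof. by move=> mA; rewrite fineK// fin_num_measure. Qed.

Lemma prob_ge0 A : 0 <= prob A.
Proof. exact: fine_ge0. Qed.

Lemma prob_le1 A : measurable A -> prob A <= 1.
Proof. by move=> mA; rewrite -lee_fin probK// probability_le1. Qed.

Lemma prob0 : prob set0 = 0.
Proof. by rewrite /prob measure0. Qed.

Lemma probT : prob setT = 1.
Proof. by rewrite /prob probability_setT. Qed.

Lemma le_prob A B : measurable A -> measurable B -> A `<=` B -> prob A <= prob B.
Proof. by move=> mA mB AB; rewrite -lee_fin !probK// le_measure ?inE. Qed.

Lemma probU A B : measurable A -> measurable B -> A `&` B = set0 ->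
  prob (A `|` B) = prob A + prob B.
Proof.
move=> mA mB AB; apply: EFin_inj; rewrite EFinD !probK ?measureU//.
exact: measurableU.
Qed.

Lemma probD A B : measurable A -> measurable B -> B `<=` A ->
  prob (A `\` B) = prob A - prob B.
Proof.
move=> mA mB BA; rewrite -{2}(setDUK BA) probU//; last by rewrite setDIK.
  by rewrite addrAC subrr add0r.
exact: measurableD.
Qed.

Lemma probC A : measurable A -> prob (~` A) = 1 - prob A.
Proof. by move=> mA; rewrite -setTD probD// probT. Qed.

Hypothesis P_atomless : atomless P.

(** Of a part of intermediate probability and its complement in the event, one carries at most half
    the mass; this halving is iterated. *)
Lemma atomless_small A (e : R) : measurable A -> 0 < prob A -> 0 < e ->
  exists B, [/\ measurable B, B `<=` A & 0 < prob B <= e].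
Proof.
move=> mA A0 e0.
have halve C : measurable C -> 0 < prob C ->
    exists B, [/\ measurable B, B `<=` C & 0 < prob B <= prob C / 2].
  move=> mC C0; have [|B [mB BC]] := P_atomless mC.
    by rewrite -probK.
  rewrite -!probK// !lte_fin => B0 BltC.
  have [B_le|B_gt] := leP (prob B) (prob C / 2); first by exists B; rewrite B0.
  exists (C `\` B); split; [exact: measurableD|exact: subDsetl|].
  by rewrite probD//; lra.
have iter_halve n : exists B, [/\ measurable B, B `<=` A &
    0 < prob B <= (2 ^+ n)^-1].
  elim: n => [|n [B [mB BA /andP[B0 Bn]]]].
    by exists A; split => //; rewrite A0 expr0 invr1 prob_le1.
  have [C [mC CB /andP[C0 Cn]]] := halve B mB B0.
  exists C; split => //; first exact: subset_trans BA.
  by rewrite C0 (le_trans Cn)// exprSr invfM ler_pM2r.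
have [n en] : exists n, (2 ^+ n)^-1 <= e.
  exists (Num.truncn e^-1).+1.
  rewrite -[leRHS]invrK lef_pV2 ?posrE ?exprn_gt0 ?invr_gt0//.
  rewrite (le_trans (ltW (truncnS_gt _)))// -natrX ler_nat.
  exact/ltnW/ltn_expl.
have [B [mB BA /andP[B0 Bn]]] := iter_halve n.
by exists B; split => //; rewrite B0 (le_trans Bn).
Qed.

(** Sierpinski's theorem on intermediate values. The event is the union of a greedily built
    sequence: if its probability stayed below t, a small event outside the union could still be
    added to every term. *)
Lemma sierpinski A (t : R) : measurable A -> 0 <= t <= prob A ->
  exists B, [/\ measurable B, B `<=` A & prob B = t].
Proof.
move=> mA /andP[t0 tA].
pose ok C := [/\ measurable C, C `<=` A & prob C <= t].
(* Greedy exhaustion: each step gains at least half of what can be gained. *)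
have greedy C : exists D, ok C -> [/\ ok D, C `<=` D & forall E, ok E -> C `<=` E ->
    prob E - prob C <= 2 * (prob D - prob C)].
  have [okC|] := pselect (ok C); last by exists C.
  pose S := [set prob E | E in [set E | ok E /\ C `<=` E]].
  have ubS : ubound S t by move=> _ [E [[_ _ Et] _] <-].
  have SC : S (prob C) by exists C => //; split.
  have leS E : ok E -> C `<=` E -> prob E <= sup S.
    by move=> okE CE; apply: ub_le_sup; [exists t|exists E].
  have [supC|supC] := leP (sup S) (prob C).
    by exists C => _; split => // E okE CE; have := leS E okE CE; lra.
  have [||_ [D [okD CD] <-] Dsup] := @sup_adherent _ S ((sup S - prob C) / 2).
  - by lra.
  - by split; [exists (prob C)|exists t].
  exists D => _; split => // E okE CE.
  by have := leS E okE CE; lra.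
have [F FP] := choice greedy.
pose B n := iter n F set0.
have okB n : ok (B n).
  elim: n => [|n IH /=]; last by have [] := FP _ IH.
  by split; [exact: measurable0|exact: sub0set|rewrite prob0].
have mB n : measurable (B n) by have [] := okB n.
have ndB : nondecreasing_seq B.
  by apply/nondecreasing_seqP => n; apply/subsetPset; have [] := FP _ (okB n).
have mU : measurable (\bigcup_n B n) by exact: bigcupT_measurable.
have UA : \bigcup_n B n `<=` A by apply: bigcup_sub => n _; have [] := okB n.
have Ut : prob (\bigcup_n B n) <= t.
  rewrite -lee_fin probK//.
  apply: cvge_le (nondecreasing_cvg_mu (mu := P) mB mU ndB).
  by apply: nearW => n /=; rewrite -probK// lee_fin; have [] := okB n.
have [Ut'|Ut'] := eqVneq (prob (\bigcup_n B n)) t; first by exists (\bigcup_n B n).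
have {Ut' Ut} Ut : prob (\bigcup_n B n) < t by rewrite lt_neqAle Ut'.
have [|||E [mE EA /andP[E0 Et]]] :=
  @atomless_small (A `\` \bigcup_n B n) (t - prob (\bigcup_n B n)).
- exact: measurableD.
- by rewrite probD//; lra.
- by lra.
(* [E] competes at every greedy step, so each step gains at least half of P(E), and more than 2 /
   P(E) steps would push the probability above 1. *)
have gain n : prob E <= 2 * (prob (B n.+1) - prob (B n)).
  have BE : B n `&` E = set0.
    by rewrite -subset0 => w [Bw /EA[_]]; apply; exists n.
  have <- : prob (B n `|` E) - prob (B n) = prob E.
    by rewrite probU// addrAC subrr add0r.
  have [_ _] := FP _ (okB n); apply => //; split.
  - exact: measurableU.
  - by move=> w [Bw|/EA[]//]; apply: UA; exists n.
  - rewrite probU//.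
    have : prob (B n) <= prob (\bigcup_n B n).
      by apply: le_prob => //; exact: bigcup_sup.
    by lra.
have many n : n%:R * prob E <= 2 * prob (B n).
  elim: n => [|n IH]; first by rewrite mul0r mulr_ge0// prob_ge0.
  by have := gain n; rewrite -natr1 mulrDl mul1r; lra.
exfalso.
have : 2 / prob E < (Num.truncn (2 / prob E)).+1%:R by exact: truncnS_gt.
have := many (Num.truncn (2 / prob E)).+1.
rewrite ltr_pdivrMr//; have := prob_le1 (mB (Num.truncn (2 / prob E)).+1); lra.
Qed.

End Sierpinski.

(** * Quantiles and tail events *)

Section Quantile.
Context (d : measure_display) (T : measurableType d) (R : realType).
Variable P : probability T R.
Implicit Types X Y : Linfty P.

Lemma Linfty_measurable X : measurable_fun setT (X : T -> R).
Proof. exact: measurable_funPT. Qed.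

Lemma measurable_le X (x : R) : measurable [set w | X w <= x].
Proof.
by rewrite -[X in measurable X]setTI; apply: measurable_fun_le.
Qed.

Lemma measurable_ge X (x : R) : measurable [set w | x <= X w].
Proof.
by rewrite -[X in measurable X]setTI; apply: measurable_fun_le.
Qed.

Lemma cdf_prob X x : cdf (P := P) X x = (prob P [set w | X w <= x])%:E.
Proof.
rewrite probK; last exact: measurable_le.
rewrite /cdf /distribution /pushforward; congr (P _).
Qed.

(** The Galois connection between quantile and cdf. The limits of the cdf at both infinities make
    the infimum finite, and right continuity makes it attained. *)
Lemma VaR_le X (s x : R) : 0 < s -> s < 1 ->
  (VaR s X <= x) = (s%:E <= cdf (P := P) X x)%E.
Proof.
move=> s0 s1; pose S := [set y : R | (s%:E <= cdf (P := P) X y)%E].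
have S0 : S !=set0.
  apply: contrapT => /forallNP Ss; move: s1; apply/negP; rewrite -leNgt -lee_fin.
  apply: cvge_le (cvg_cdfy1 X); apply: nearW => y /=.
  by rewrite leNgt; apply/negP => /ltW /Ss.
have [y yS] : exists y, (cdf (P := P) X y < s%:E)%E.
  apply: contrapT => /forallNP Ss; move: s0; apply/negP; rewrite -leNgt -lee_fin.
  apply: cvge_ge (cvg_cdfNy0 X); apply: nearW => y /=.
  by rewrite leNgt; apply/negP => /Ss.
have lbS : lbound S y.
  move=> z; rewrite /S/= => sz; rewrite leNgt; apply/negP => zy.
  have := lt_le_trans yS sz; rewrite ltNge => /negP; apply.
  by apply: cdf_nondecreasing; exact: ltW.
apply/idP/idP => [Vx|sx]; last by apply: ge_inf => //; exists y.
have Se e : x < e -> (s%:E <= cdf (P := P) X e)%E.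
  move=> xe; have [z Sz ze] := inf_lt S0 (le_lt_trans Vx xe).
  by apply: (le_trans Sz); apply: cdf_nondecreasing; exact: ltW.
have cvr : cdf (P := P) X y @[y --> x^'+] --> cdf (P := P) X x.
  exact: cdf_right_continuous.
apply: cvge_ge cvr.
by near=> e; apply: Se; near: e; exact: nbhs_right_gt.
Unshelve. all: by end_near. Qed.

(** The event is an increasing union of events X <= VaR - 1/(n+1), each of probability below s by
    [VaR_le]. *)
Lemma prob_lt_VaR X (s : R) : 0 < s -> s < 1 -> prob P [set w | X w < VaR s X] <= s.
Proof.
move=> s0 s1.
have -> : [set w | X w < VaR s X] =
    \bigcup_n [set w | X w <= VaR s X - n.+1%:R^-1].
  apply/seteqP; split => w /=.
    move=> h; have [n nP] := ltr_add_invr h.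
    by exists n => //=; rewrite lerBrDr ltW.
  by move=> [n _ /= h]; apply: le_lt_trans h _; rewrite gtrBl invr_gt0.
set F := fun n => _.
have mF n : measurable (F n) by exact: measurable_le.
have mU : measurable (\bigcup_n F n) by exact: bigcupT_measurable.
have ndF : nondecreasing_seq F.
  move=> m n mn; apply/subsetPset => w /= /le_trans; apply.
  by rewrite lerB// lef_pV2 ?posrE// ler_nat.
rewrite -lee_fin probK//.
apply: cvge_le (nondecreasing_cvg_mu (mu := P) mF mU ndF).
apply: nearW => n /=; rewrite -probK// /F -cdf_prob leNgt.
apply/negP => /ltW; rewrite -VaR_le// leNgt => /negP; apply.
by rewrite gtrBl invr_gt0.
Qed.

Lemma prob_le_VaR X (s : R) : 0 < s -> s < 1 ->
  s <= prob P [set w | X w <= VaR s X].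
Proof. by move=> s0 s1; rewrite -lee_fin -cdf_prob -VaR_le. Qed.

(** A pointwise form of the tail condition, with its threshold explicit and without an exceptional
    null set. *)
Definition separates (A : set T) (q : R) (X : T -> R) :=
  (forall w, A w -> q <= X w) /\ (forall w, ~ A w -> X w <= q).

(** The complement of A consists of the event X < q for the p-quantile q and of a piece of the event
    X = q, which [sierpinski] cuts so that the total is exactly p. *)
Lemma separating_set X (p : R) : atomless P -> 0 < p -> p < 1 ->
  exists A q, [/\ measurable A, prob P A = 1 - p & separates A q X].
Proof.
move=> at_ p0 p1; pose q := VaR p X.
pose L := [set w | X w < q]; pose M := [set w | X w <= q].
have mM : measurable M by exact: measurable_le.
have LE : L = ~` [set w | q <= X w].
  by apply/seteqP; split => w /=; rewrite /L /= ltNge => /negP.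
have mL : measurable L by rewrite LE; apply: measurableC; exact: measurable_ge.
have LM : L `<=` M by move=> w /ltW.
have Lp : prob P L <= p by exact: prob_lt_VaR.
have Mp : p <= prob P M by exact: prob_le_VaR.
have [||B [mB BML Bp]] := @sierpinski _ _ _ P at_ (M `\` L) (p - prob P L).
- exact: measurableD.
- by rewrite probD//; lra.
exists (~` (L `|` B)), q; split.
- by apply/measurableC/measurableU.
- rewrite probC; last exact: measurableU.
  rewrite probU ?Bp//; first lra.
  by rewrite -subset0 => w [Lw /BML[]].
- split => w /=.
    by move=> /not_orP[+ _]; rewrite /L/= => /negP; rewrite -leNgt.
  by move=> /contrapT[/ltW//|/BML[]].
Qed.

End Quantile.

(** * Expected shortfall as a tail mean *)

Section Transfer.
Context (d : measure_display) (T : measurableType d) (R : realType).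
Variable P : probability T R.
Implicit Types X Y : Linfty P.
Local Notation mu := (@lebesgue_measure R).

Lemma measurable_VaR X :
  measurable_fun (`]0, 1[%classic : set R) (fun s => VaR s X).
Proof.
move=> mD; apply: (measurability _ (RGenOInfty.measurableE R)) => //.
move=> /= _ [_ [x ->] <-].
have -> : `]0, 1[%classic `&` (fun s => VaR s X) @^-1` `]x, +oo[%classic =
    `]0, 1[%classic `&` `]fine (cdf (P := P) X x), +oo[%classic.
  have VE (s : R) : 0 < s -> s < 1 -> (x < VaR s X) = (fine (cdf (P := P) X x) < s).
    by move=> s0 s1; rewrite ltNge VaR_le// cdf_prob lee_fin -ltNge.
  apply/seteqP; split => s /=; rewrite !in_itv /= !andbT => -[/andP[s0 s1]];
    by rewrite VE// s0 s1.
by apply: measurableI => //; exact: measurable_itv.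
Qed.

Lemma integral_uniform01 (f : R -> \bar R) :
  measurable_fun setT f -> (forall x, 0 <= f x)%E ->
  (\int[uniform_prob (@ltr01 R)]_x f x = \int[mu]_(x in `]0%R, 1%R[) f x)%E.
Proof.
move=> mf f0; rewrite integral_uniform// subr0 invr1 mul1e.
rewrite -integral_itv_bndo_bndc; last exact: measurable_funTS.
by rewrite -integral_itv_obnd_cbnd//; exact: measurable_funTS.
Qed.

Lemma uniform_prob01 (B : set R) : measurable B ->
  uniform_prob (@ltr01 R) B = mu (B `&` `]0, 1[%classic).
Proof.
move=> mB; rewrite -[B in LHS]setIT -integral_indic//.
by rewrite integral_uniform01 ?integral_indic//; [exact/measurable_EFinP].
Qed.

(** The quantile transform: for s uniform on ]0, 1[, VaR_s(X) has the law of X. Both sides are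
    integrals of tail probabilities over r > 0, and these agree by [VaR_le]. *)
Lemma integral_VaR_excess X (t : R) :
  (\int[mu]_(s in `]0%R, 1%R[) (Num.max (VaR s X - t) 0)%:E =
   \int[P]_w (Num.max (X w - t) 0)%:E)%E.
Proof.
(* Outside ]0, 1[ the infimum in [VaR] need not be a quantile, so it is replaced by 0 to get a
   measurable function on the whole line. *)
pose V : R -> R := (fun s => VaR s X) \_ `]0, 1[%classic.
have mV : measurable_fun setT V.
  by apply: (measurable_restrictT _ _).1 => //; exact: measurable_VaR.
pose V' s := Num.max (V s - t) 0.
have mV' : measurable_fun setT V'.
  by apply: measurable_maxr => //; exact: measurable_funB.
pose X' w := Num.max (X w - t) 0.
have mX' : measurable_fun setT X'.
  by apply: measurable_maxr => //; exact: measurable_funB.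
transitivity (\int[mu]_(s in `]0%R, 1%R[) (V' s)%:E)%E.
  by apply: eq_integral => s s01; rewrite /V' /V patchE s01.
rewrite -integral_uniform01; last 2 first.
- exact/measurable_EFinP.
- by move=> x; rewrite lee_fin /V' le_max lexx orbT.
pose fV : {RV uniform_prob (@ltr01 R) >-> R} :=
  @mfun_Sub _ _ (measurableTypeR R) R V' (mem_set mV').
have := @ge0_expectation_ccdf _ _ _ (uniform_prob (@ltr01 R)) fV.
rewrite unlock => ->; last by move=> x; rewrite /= /V' le_max lexx orbT.
have := @ge0_expectation_ccdf _ _ _ P (mfun_Sub (mem_set mX')).
rewrite unlock => ->; last by move=> x; rewrite /= /X' le_max lexx orbT.
apply: eq_integral => r; rewrite inE/= in_itv/= andbT => r0.
rewrite /ccdf /distribution /pushforward.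
have -> : mfun_Sub (mem_set mX') @^-1` `]r, +oo[ = ~` [set w | X w <= t + r].
  apply/seteqP; split => w /=; rewrite in_itv /= andbT /X' lt_max (ltNge r 0) r0 orbF
    ltrBrDl ltNge => /negP//.
rewrite probability_setC ?measurable_le//; last exact: measurable_le.
rewrite -(probK P (measurable_le _ _)) -cdf_prob.
have mB : measurable (fV @^-1` `]r, +oo[).
  by have := mV' measurableT _ (measurable_itv `]r, +oo[); rewrite setTI.
transitivity (uniform_prob (@ltr01 R) (fV @^-1` `]r, +oo[)) => //.
rewrite uniform_prob01// cdf_prob.
have -> : fV @^-1` `]r, +oo[ `&` `]0, 1[ =
    `]prob P [set w | X w <= t + r], 1[%classic.
  have VE (s : R) : 0 < s -> s < 1 ->
      (r < V' s) = (prob P [set w | X w <= t + r] < s).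
    move=> s0 s1; rewrite /V' lt_max (ltNge r 0) r0 orbF ltrBrDl.
    rewrite /V patchE mem_set/= ?in_itv/= ?s0//.
    by rewrite ltNge VaR_le// cdf_prob lee_fin -ltNge.
  apply/seteqP; split => s /=; rewrite !in_itv /= !andbT.
    by move=> [+ /andP[s0 s1]]; rewrite VE// s1 andbT.
  move=> /andP[Fs s1]; have s0 : 0 < s by rewrite (le_lt_trans _ Fs)// prob_ge0.
  by rewrite VE// s0 s1.
rewrite lebesgue_measure_itv/= lte_fin -EFinB.
(* When the cdf at t + r is 1 the interval is empty, and both sides are 0. *)
case: ltP => // h; congr EFin; apply/eqP.
by rewrite eq_sym subr_eq0 eq_le h prob_le1//; exact: measurable_le.
Qed.

End Transfer.

Section PartialMean.
Context (d : measure_display) (T : measurableType d) (R : realType).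
Variable P : probability T R.
Implicit Types (X Y : Linfty P) (A B : set T).
Local Notation mu := (@lebesgue_measure R).

Lemma integrable_Linfty X A : measurable A -> P.-integrable A (EFin \o X).
Proof.
move=> mA; apply: (integrableS measurableT) => //.
apply/Lfun1_integrable; apply: (@Lfun_subset _ _ _ P 1%E +oo%E) => //.
- by rewrite leey.
- by rewrite fin_num_measure.
- by rewrite leey.
- exact: LfunP.
Qed.

Lemma integrable_excess X t A : measurable A ->
  P.-integrable A (EFin \o (fun w => Num.max (X w - t) 0)).
Proof.
move=> mA; have iXt : P.-integrable A (EFin \o (fun w => X w - t)).
  exact: (integrable_Linfty (X - cstL P t) mA).
have := integrable_funepos mA iXt; congr (integrable _ _ _).
by apply/funext => w; rewrite funeposE /= EFin_max.
Qed.

Definition pmean A X : R := \int[P]_(w in A) X w.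
(** The stop-loss premium of X at level t. *)
Definition excess X t : R := \int[P]_w Num.max (X w - t) 0.

Lemma meanE X : mean X = pmean setT X.
Proof. by rewrite /mean unlock. Qed.

Lemma pmeanD A X Y : measurable A -> pmean A (X + Y) = pmean A X + pmean A Y.
Proof. by move=> mA; rewrite /pmean RintegralD//; exact: integrable_Linfty. Qed.

Lemma pmeanZ A a X : measurable A -> pmean A (a *: X) = a * pmean A X.
Proof. by move=> mA; rewrite /pmean RintegralZl//; exact: integrable_Linfty. Qed.

Lemma pmean_cst A c : measurable A -> pmean A (cstL P c) = c * prob P A.
Proof. by move=> mA; rewrite /pmean Rintegral_cst. Qed.

Lemma pmean_le A X Y : measurable A -> (forall w, A w -> X w <= Y w) ->
  pmean A X <= pmean A Y.
Proof.
by move=> mA XY; apply: le_Rintegral => //; exact: integrable_Linfty.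
Qed.

Lemma pmeanC A X : measurable A -> mean X = pmean A X + pmean (~` A) X.
Proof.
move=> mA; rewrite meanE -(setvU A) setUC /pmean Rintegral_setU//.
- exact: measurableC.
- by apply: integrable_Linfty; rewrite setUv.
- by apply/disj_setPS => w [].
Qed.

(** Integrate X - t <= (X - t)^+ over A, then enlarge A to the whole space. With the equality case
    [pmean_separates], this yields the Rockafellar-Uryasev formula for ES. *)
Lemma pmean_le_excess X t A : measurable A ->
  pmean A X <= t * prob P A + excess X t.
Proof.
move=> mA; rewrite -lerBlDl -pmean_cst// -RintegralB//; last 2 first.
  exact: integrable_Linfty. exact: integrable_Linfty.
apply: (@le_trans _ _ (\int[P]_(w in A) Num.max (X w - t) 0)).
  apply: le_Rintegral => //; last by move=> w _; rewrite le_max lexx.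
    exact: (integrable_Linfty (X - cstL P t) mA).
  exact: integrable_excess.
rewrite /excess -[in leRHS](setUv A) Rintegral_setU//.
- by rewrite lerDl; apply: Rintegral_ge0 => w _; rewrite le_max lexx orbT.
- exact: measurableC.
- by apply: integrable_excess; rewrite setUv.
- by apply/disj_setPS => w [].
Qed.

Lemma pmean_separates A q X : measurable A -> separates A q X ->
  pmean A X = q * prob P A + excess X q.
Proof.
move=> mA [Aq qA]; rewrite -[LHS](subrK (q * prob P A)) addrC; congr (_ + _).
rewrite -pmean_cst// -RintegralB//; last 2 first.
  exact: integrable_Linfty. exact: integrable_Linfty.
rewrite /excess Rintegral_mkcond; apply: eq_Rintegral => w _; rewrite patchE.
case: ifPn => [|/negP]; rewrite in_setE => Aw /=.
  by rewrite max_l// subr_ge0 Aq.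
by rewrite max_r// subr_le0 qA.
Qed.

Variable p : R.
Hypotheses (p0 : 0 < p) (p1 : p < 1).

(** On ]p, 1[ one has VaR_s = q + (VaR_s - q)^+. The positive part vanishes for s <= p, so its
    integral extends to ]0, 1[, where [integral_VaR_excess] turns it into [excess X q]. *)
Lemma ES_separates A q X : measurable A -> prob P A = 1 - p -> separates A q X ->
  (1 - p) * ES p X = pmean A X.
Proof.
move=> mA Ap AqX; have [Aq qA] := AqX; rewrite (pmean_separates mA AqX) Ap.
rewrite /ES mulrA divff ?mul1r; last by rewrite subr_eq0 eq_sym lt_eqF.
have p01 : `]p, 1[%classic `<=` (`]0, 1[%classic : set R).
  by move=> s /=; rewrite !in_itv/= => /andP[ps ->]; rewrite (lt_trans p0 ps).
have VaR_lo s : 0 < s -> s <= p -> VaR s X <= q.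
  move=> s0 sp; rewrite VaR_le// ?(le_lt_trans sp)// cdf_prob lee_fin.
  rewrite (le_trans sp)//; have -> : p = prob P (~` A) by rewrite probC// Ap; lra.
  by apply: le_prob; [exact: measurableC|exact: measurable_le|move=> w /qA].
have VaR_hi s : p < s -> s < 1 -> q <= VaR s X.
  move=> ps s1; have s0 := lt_trans p0 ps.
  rewrite leNgt; apply/negP => h; have := prob_le_VaR X s0 s1.
  apply/negP; rewrite -ltNge (le_lt_trans _ ps)//.
  have -> : p = prob P (~` A) by rewrite probC// Ap; lra.
  apply: le_prob; [exact: measurable_le|exact: measurableC|].
  by move=> w /= Xw /Aq; rewrite leNgt (le_lt_trans Xw).
have E : (\int[mu]_(s in `]p, 1%R[) (Num.max (VaR s X - q) 0)%:E =
    \int[P]_w (Num.max (X w - q) 0)%:E)%E.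
  rewrite -integral_VaR_excess integral_mkcond [RHS]integral_mkcond.
  apply: eq_integral => s _; rewrite !patchE.
  case: ifPn => [/set_mem/p01 sp|]; first by rewrite mem_set.
  move=> /negP sp; case: ifPn => // /set_mem s01.
  have /andP[s0 s1] : 0 < s < 1 by move: s01; rewrite /= in_itv.
  rewrite max_r// subr_le0 VaR_lo// leNgt; apply/negP => ps; apply: sp.
  by rewrite mem_set//= in_itv/= ps.
transitivity (\int[mu]_(s in `]p, 1[) (q + Num.max (VaR s X - q) 0)).
  apply: eq_Rintegral => s /set_mem; rewrite /= in_itv/= => /andP[ps s1].
  by rewrite max_l ?subr_ge0 ?VaR_hi// addrC subrK.
have mI : measurable (`]p, 1[%classic : set (measurableTypeR R)).
  exact: measurable_itv.
have i1 : mu.-integrable (`]p, 1[%classic : set (measurableTypeR R))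
    (EFin \o cst q).
  apply/integrableP; split; first exact/measurable_EFinP/measurable_cst.
  rewrite /= integral_cst//= lebesgue_measure_itv/= lte_fin p1.
  by rewrite -EFinB -EFinM ltry.
have i2 : mu.-integrable (`]p, 1[%classic : set (measurableTypeR R))
    (EFin \o (fun s => Num.max (VaR s X - q) 0)).
  apply/integrableP; split.
    apply/measurable_EFinP; apply: measurable_maxr => //.
    apply: measurable_funB => //; apply: measurable_funS p01 _ => //.
    exact: measurable_VaR.
  under eq_integral do rewrite /= ger0_norm ?le_max ?lexx ?orbT//.
  have /integrableP[_] := integrable_excess X q measurableT.
  rewrite E; congr (_ < _)%E; apply: eq_integral => w _ /=.
  by rewrite ger0_norm// le_max lexx orbT.
rewrite RintegralD// Rintegral_cst//= lebesgue_measure_itv/= lte_fin p1/=.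
by rewrite /excess /Rintegral E.
Qed.

Lemma ES_ge B X : atomless P -> measurable B -> prob P B = 1 - p ->
  pmean B X <= (1 - p) * ES p X.
Proof.
move=> at_ mB Bp; have [A [q [mA Ap AqX]]] := separating_set X at_ p0 p1.
rewrite (ES_separates mA Ap AqX) (pmean_separates mA AqX) Ap -Bp.
exact: pmean_le_excess.
Qed.

(** This bounds ES through the mean of an increasing convex function of X, which is what the
    increasing convex order can compare. *)
Lemma ES_le_excess X t : atomless P -> (1 - p) * ES p X <= t * (1 - p) + excess X t.
Proof.
move=> at_; have [A [q [mA Ap AqX]]] := separating_set X at_ p0 p1.
by rewrite (ES_separates mA Ap AqX) -Ap; exact: pmean_le_excess.
Qed.

End PartialMean.

(** * Indicators, equality in law and bounded representatives *)

Section Bounded.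
Context (d : measure_display) (T : measurableType d) (R : realType).
Variable P : probability T R.
Implicit Types (X Y : Linfty P) (A B : set T).

Lemma LinftyD X Y w : (X + Y) w = X w + Y w. Proof. by []. Qed.

Lemma LinftyZ a X w : (a *: X) w = a * X w. Proof. by []. Qed.

Lemma Linfty_sum (F : nat -> Linfty P) n w :
  (\sum_(i < n) F i) w = \sum_(i < n) F i w.
Proof.
elim: n => [|n IH]; first by rewrite !big_ord0.
by rewrite !big_ord_recr/= -IH.
Qed.

Lemma bounded_Linfty (f : T -> R) M : measurable_fun setT f ->
  (forall w, `|f w| <= M) -> f \in Lfun P +oo.
Proof.
move=> mf fM; apply/andP; split; first by rewrite inE.
apply: mem_set; rewrite /= /finite_norm unlock /=.
case: ifP => _; last exact: ltry.
apply: (@le_lt_trans _ _ M%:E); last exact: ltry.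
by apply: ereal_inf_lbound; apply: nearW => w; rewrite /= lee_fin.
Qed.

(** For a non-measurable A the indicator is not in [Linfty] and [insubd] returns 0, whence the
    measurability hypothesis of [indE]. *)
Definition ind A : Linfty P := insubd 0 (\1_A : T -> R).

Lemma indE A w : measurable A -> ind A w = (w \in A)%:R.
Proof.
move=> mA; rewrite /ind val_insubd (@bounded_Linfty _ 1).
- by rewrite indicE.
- exact: measurable_indic.
- by move=> x; rewrite indicE ger0_norm// lern1 leq_b1.
Qed.

Lemma pmean_ind A B : measurable A -> measurable B -> B `<=` A ->
  pmean A (ind B) = prob P B.
Proof.
move=> mA mB BA; rewrite /pmean /Rintegral -[B in RHS](setIidl BA) /prob.
rewrite -integral_indic//; congr fine; apply: eq_integral => w _.
by rewrite indE// indicE.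
Qed.

(** The preimage of S is the whole space, the event, its complement or empty, according to whether c
    and 0 lie in S; only the probability of the event matters. *)
Lemma eq_in_law_ind c B B' : measurable B -> measurable B' ->
  prob P B = prob P B' -> eq_in_law (c *: ind B) (c *: ind B').
Proof.
move=> mB mB' BB' S mS.
have lawE D : measurable D -> distribution P (c *: ind D) S =
    (if c \in S then if 0 \in S then 1 else prob P D
     else if 0 \in S then 1 - prob P D else 0)%:E.
  move=> mD; rewrite /distribution /pushforward.
  have val w : (c *: ind D) w = if w \in D then c else 0.
    by rewrite LinftyZ indE//; case: (w \in D); rewrite ?mulr1 ?mulr0.
  have pre w : ((c *: ind D) @^-1` S) w = S (if w \in D then c else 0).
    by rewrite -val.
  case: ifPn => cS; case: ifPn => S0.
  - transitivity (P setT); last exact: probability_setT.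
    congr (P _); apply/seteqP; split => // w _; rewrite pre.
    by case: ifP => _; exact/set_mem.
  - rewrite probK//; congr (P _); apply/seteqP; split => w; rewrite pre.
      by case: ifPn => [/set_mem//|_ /mem_set]; rewrite (negbTE S0).
    by move=> wD; rewrite mem_set//; exact/set_mem.
  - rewrite -probC// probK; last exact: measurableC.
    congr (P _); apply/seteqP; split => w; rewrite pre.
      by case: ifPn => [_ /mem_set|/negP wD _ Dw];
        [rewrite (negbTE cS)|exact/wD/mem_set].
    by move=> wD; rewrite memNset//; exact/set_mem.
  - transitivity (P set0); last exact: measure0.
    congr (P _); apply/seteqP; split => w //.
    by rewrite pre; case: ifP => _ /mem_set; rewrite ?(negbTE cS) ?(negbTE S0).
by rewrite !lawE// BB'.
Qed.

Lemma ae_eq_in_law X Y : (\forall w \ae P, X w = Y w) -> eq_in_law X Y.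
Proof.
move=> [N [mN N0 XYN]] S mS; rewrite /distribution /pushforward.
have mP (Z : Linfty P) : measurable (Z @^-1` S : set T).
  by rewrite -[X in measurable X]setTI; exact: Linfty_measurable.
have PN (Z : Linfty P) : P (Z @^-1` S) = P (Z @^-1` S `\` N).
  rewrite (measureDI P (mP Z) mN) [X in (_ + X)%E](subset_measure0 _ mN)//.
    by rewrite adde0.
  exact: measurableI.
rewrite PN [RHS]PN; congr (P _).
have XY w : ~ N w -> X w = Y w by apply: contra_notP => h; exact: XYN.
by apply/seteqP; split => w [] /= + Nw; rewrite XY.
Qed.

Lemma ae_eq_pmean X Y A : measurable A -> (\forall w \ae P, X w = Y w) ->
  pmean A X = pmean A Y.
Proof.
move=> mA XY; rewrite /pmean /Rintegral; congr fine; apply: ae_eq_integral => //.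
- by apply/measurable_EFinP; apply: measurable_funTS; exact: Linfty_measurable.
- by apply/measurable_EFinP; apply: measurable_funTS; exact: Linfty_measurable.
- by apply: filterS XY => w -> _.
Qed.

Lemma eq_in_law_ES X Y p : eq_in_law X Y -> ES p X = ES p Y.
Proof.
move=> XY; rewrite /ES; congr (_ * _); congr (Rintegral _ _ _).
apply/funext => s; rewrite /VaR; congr inf; apply/seteqP.
by split => x /=; rewrite /cdf XY.
Qed.

(** Elements of [Linfty] are only essentially bounded, whereas the uniform approximation used later
    needs a pointwise bound. *)
Lemma Linfty_truncation X : exists Y (M : R),
  (forall w, `|Y w| <= M) /\ (\forall w \ae P, X w = Y w).
Proof.
have [M XM] : exists M : R, \forall w \ae P, `|X w| <= M.
  have := LfunP X; rewrite inE => /andP[_]; rewrite inE/= /finite_norm unlock.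
  have PT : (0 < P setT)%E by rewrite probability_setT.
  by rewrite ifT// => /ess_sup_inf.ess_supr_bounded[M XM]; exists M.
pose N := Num.max M 0.
pose f w := Num.max (- N) (Num.min N (X w)).
have mf : measurable_fun setT f.
  apply: measurable_maxr; first exact: measurable_cst.
  by apply: measurable_minr; [exact: measurable_cst|exact: Linfty_measurable].
have N0 : 0 <= N by rewrite /N le_max lexx orbT.
have fN w : `|f w| <= N.
  rewrite ler_norml /f le_max lexx/= ge_max ge_min lexx andbT.
  by rewrite (le_trans _ N0)// oppr_le0.
exists (Lfun_Sub (leey 1%E) (bounded_Linfty mf fN)), N; split; first exact: fN.
apply: filterS XM => w; rewrite ler_norml => /andP[lo hi] /=.
have MN : M <= N by rewrite /N le_max lexx.
rewrite /f min_r ?(le_trans hi)// max_r// (le_trans _ lo)// lerN2//.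
Qed.

End Bounded.

(** * Averaging on a tail event *)

Section Separation.
Context (d : measure_display) (T : measurableType d) (R : realType).
Variable P : probability T R.
Implicit Types (X Y W : Linfty P) (A B : set T).

(** For fixed A these variables form a convex cone containing the constants, and any two of them are
    p-concentrated if P(A) = 1 - p. *)
Definition tail_on A X := exists q, separates A q X.

Lemma tail_onD A X Y : tail_on A X -> tail_on A Y -> tail_on A (X + Y).
Proof.
move=> [q [Xq qX]] [r [Yr rY]]; exists (q + r); split => w Aw; rewrite LinftyD.
  by rewrite lerD ?Xq ?Yr.
by rewrite lerD ?qX ?rY.
Qed.

Lemma tail_onZ A a X : 0 <= a -> tail_on A X -> tail_on A (a *: X).
Proof.
move=> a0 [q [Xq qX]]; exists (a * q); split => w Aw; rewrite LinftyZ.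
  by rewrite ler_wpM2l ?Xq.
by rewrite ler_wpM2l ?qX.
Qed.

Lemma tail_on_cst A c : tail_on A (cstL P c).
Proof. by exists c; split. Qed.

Lemma tail_on_p_tail_event p A X : 0 < p -> p < 1 -> measurable A ->
  prob P A = 1 - p -> tail_on A X -> p_tail_event p A X.
Proof.
move=> p0 p1 mA Ap [q [Aq qA]]; have PA : P A = (1 - p)%:E by rewrite -Ap probK.
split => //; split => //.
- by rewrite PA lte_fin subr_gt0.
- by rewrite PA lte_fin gtrBl.
- exists set0; first exact: negligible_set0.
  by move=> w w' Aw Aw' _ _; exact: le_trans (qA _ Aw') (Aq _ Aw).
Qed.

Lemma ge0_tail_on_ind A B c : measurable B -> B `<=` A -> 0 <= c ->
  tail_on A (c *: ind P B).
Proof.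
move=> mB BA c0; exists 0; split => w Aw; rewrite LinftyZ indE//.
  by rewrite mulr_ge0.
by rewrite memNset ?mulr0// => /BA.
Qed.

Lemma le0_tail_on_ind A B c : measurable B -> B `<=` ~` A -> c <= 0 ->
  tail_on A (c *: ind P B).
Proof.
move=> mB BA c0; exists 0; split => w Aw; rewrite LinftyZ indE//.
  by rewrite memNset ?mulr0// => /BA.
by rewrite mulr_le0_ge0.
Qed.

End Separation.

Section Averaging.
Context (d : measure_display) (T : measurableType d) (R : realType).
Variables (P : probability T R) (p : R) (rho : Linfty P -> R).
Hypotheses (P_atomless : atomless P) (p_gt0 : 0 < p) (p_lt1 : p < 1).
Hypotheses (rho_pCA : pCA p rho) (rho_mon : monetary rho).
Implicit Types (X Y W V : Linfty P) (A B : set T).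

Lemma monetary_lipschitz X Y e : (forall w, `|X w - Y w| <= e) ->
  `|rho X - rho Y| <= e.
Proof.
have [mono trans] := rho_mon.
have half X' Y' : (forall w, `|X' w - Y' w| <= e) -> rho X' <= rho Y' + e.
  move=> XY; rewrite -trans; apply: mono => w; rewrite LinftyD /=.
  by have := XY w; rewrite ler_norml => /andP[_]; rewrite lerBlDl.
move=> XY; rewrite ler_norml; apply/andP; split.
  by rewrite lerBrDl lerBlDr; apply: half => w; rewrite distrC.
by rewrite lerBlDl; apply: half.
Qed.

(** Apply [p-CA] with 0 as second variable: a constant shares every tail event of the first. *)
Lemma law_invariant X Y : eq_in_law X Y -> rho X = rho Y.
Proof.
have half X' Y' : eq_in_law X' Y' -> rho X' <= rho Y'.
  move=> XY; have [A [q [mA Ap sep]]] := separating_set Y' P_atomless p_gt0 p_lt1.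
  rewrite -[X']addr0 -[Y']addr0; apply: rho_pCA => //; exists A; split.
    by apply: tail_on_p_tail_event => //; exists q.
  by apply: tail_on_p_tail_event => //; exists 0; split.
by move=> XY; apply/eqP; rewrite eq_le !half// => S mS; rewrite XY.
Qed.

Variable A : set T.
Hypotheses (mA : measurable A) (Ap : prob P A = 1 - p).

(** This treats two cases at once: D = A with c >= 0, and D the complement of A with c <= 0. *)
Definition tail_step D c := [/\ measurable D, 0 < prob P D &
  forall B, measurable B -> B `<=` D -> tail_on A (c *: ind P B)].

Lemma tail_step_scale D c a : 0 <= a -> tail_step D c -> tail_step D (a * c).
Proof.
move=> a0 [mD D0 tD]; split => // B mB BD; rewrite -scalerA.
by apply: tail_onZ => //; exact: tD.
Qed.

(** Both indicators and W lie in the cone of A, so [p-CA] applies in both directions. *)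
Lemma swap_ind D c B B' W : tail_step D c -> measurable B -> measurable B' ->
  B `<=` D -> B' `<=` D -> prob P B = prob P B' -> tail_on A W ->
  rho (c *: ind P B + W) = rho (c *: ind P B' + W).
Proof.
move=> [mD D0 tD] mB mB' BD B'D BB' tW; apply/eqP; rewrite eq_le.
apply/andP; split; apply: rho_pCA => //.
- by exists A; split; apply: tail_on_p_tail_event => //; exact: tD.
- exact: eq_in_law_ind.
- by exists A; split; apply: tail_on_p_tail_event => //; exact: tD.
- exact: eq_in_law_ind.
Qed.

Lemma indU B B' : measurable B -> measurable B' -> B `&` B' = set0 ->
  ind P (B `|` B') = ind P B + ind P B'.
Proof.
move=> mB mB' BB'; apply/LfuneqP => w; rewrite LinftyD !indE//;
  last exact: measurableU.
rewrite in_setU; case: (boolP (w \in B)) => [/set_mem Bw|_]; last by rewrite add0r.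
by rewrite memNset ?addr0// => B'w; rewrite -[False]/(set0 w) -BB'.
Qed.

(* Moving the N copies of [c 1_B] one by one inside D, each time filling first
   the part of D covered least, yields an almost constant function on D. *)
Lemma spread_copies D c B n W : tail_step D c -> measurable B -> B `<=` D ->
  tail_on A W -> exists k E, [/\ measurable E, E `<=` D,
    k%:R * prob P D + prob P E = n%:R * prob P B &
    rho (n%:R *: (c *: ind P B) + W) =
    rho (k%:R *: (c *: ind P D) + c *: ind P E + W)].
Proof.
move=> /[dup] tDc [mD D0 tD] mB BD.
have BDp : prob P B <= prob P D by exact: le_prob.
elim: n W => [|n IH] W tW.
  exists 0%N, set0; split => //; first by rewrite prob0 !mul0r addr0.
  have -> : ind P set0 = 0 by apply/LfuneqP => w; rewrite indE// in_set0.
  by rewrite !scale0r scaler0 !add0r.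
rewrite -natr1 scalerDl scale1r -addrA.
(* The last copy is kept in the background variable while the first n are rearranged into k full
   layers and a partial layer E. *)
have [|k [E [mE ED kE ->]]] := IH (c *: ind P B + W).
  by apply: tail_onD => //; exact: tD.
have mDE : measurable (D `\` E) by exact: measurableD.
have tWE : tail_on A (k%:R *: (c *: ind P D) + c *: ind P E + W).
  by do 2 (apply: tail_onD => //); [apply: tail_onZ => //|]; apply: tD.
rewrite addrCA.
have prDE : prob P (D `\` E) = prob P D - prob P E by rewrite probD.
have [small|large] := leP (prob P B) (prob P (D `\` E)).
  have [|B' [mB' B'D B'p]] := @sierpinski _ _ _ P P_atomless _ (prob P B) mDE.
    by rewrite prob_ge0.
  have BE' : E `&` B' = set0 by rewrite -subset0 => w [Ew /B'D[]].
  exists k, (E `|` B'); split.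
  - exact: measurableU.
  - by move=> w [/ED//|/B'D[]].
  - by rewrite probU// B'p; lra.
  - rewrite (swap_ind tDc mB mB' BD _ _ tWE)//; last by move=> w /B'D[].
    by rewrite indU// scalerDr addrCA !addrA.
(* Otherwise the copy fills the rest of D, completing a layer, and its remaining mass G inside E
   starts the next one. *)
have [|G [mG GE Gp]] := @sierpinski _ _ _ P P_atomless _
    (prob P B - prob P (D `\` E)) mE.
  by lra.
have DEG : (D `\` E) `&` G = set0 by rewrite -subset0 => w [[_ Ew] /GE].
exists k.+1, G; split => //.
- exact: subset_trans ED.
- by rewrite Gp -natr1; lra.
- have mB' : measurable ((D `\` E) `|` G) by exact: measurableU.
  rewrite (swap_ind tDc mB mB' BD _ _ tWE)//.
  + have cD : c *: ind P D = c *: ind P E + c *: ind P (D `\` E).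
      by rewrite -scalerDr -indU ?setDIK ?setDUK.
    rewrite indU// -natr1 scalerDl scale1r {3}cD scalerDr.
    by rewrite addrCA !addrA.
  + by move=> w [[]//|/GE/ED].
  + rewrite probU// Gp; lra.
Qed.

(** The conditional mean E[V | D] on D, and 0 elsewhere. *)
Definition flat D V := (pmean D V / prob P D) *: ind P D.

(** Quantifying over all W in the cone, and keeping V and its average in the cone, makes the
    property stable under sums. *)
Definition flattens D V := [/\ tail_on A V, tail_on A (flat D V) &
  forall W, tail_on A W -> rho (V + W) = rho (flat D V + W)].

Lemma flattensD D V V' : measurable D -> flattens D V -> flattens D V' ->
  flattens D (V + V').
Proof.
move=> mD [tV tfV fV] [tV' tfV' fV'].
have flatD : flat D (V + V') = flat D V + flat D V'.
  by rewrite /flat pmeanD// mulrDl scalerDl.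
rewrite /flattens flatD; split; [exact: tail_onD|exact: tail_onD|move=> W tW].
rewrite -addrA fV; last exact: tail_onD.
by rewrite addrCA fV' ?[RHS]addrAC -?addrA 1?addrCA//; exact: tail_onD.
Qed.

(** Spreading n copies of (c/n) 1_B leaves k full layers and one partial layer, which is within
    |c|/n of the constant average on D. Since [rho] is Lipschitz and n is arbitrary, the two values
    of [rho] coincide. *)
Lemma flattens_ind D c B : tail_step D c -> measurable B -> B `<=` D ->
  flattens D (c *: ind P B).
Proof.
move=> /[dup] tDc [mD D0 tD] mB BD.
have flatE : flat D (c *: ind P B) = (prob P B / prob P D) *: (c *: ind P D).
  rewrite /flat pmeanZ// pmean_ind// scalerA; congr (_ *: _); ring.
have tflat : tail_on A (flat D (c *: ind P B)).
  rewrite flatE; apply: tail_onZ; last exact: tD.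
  by rewrite divr_ge0 ?prob_ge0.
split => //; first exact: tD.
move=> W tW; apply/eqP; rewrite -subr_eq0 -normr_le0; apply/ler_addgt0Pr => e e0.
rewrite add0r; pose n := (Num.truncn (`|c| / e)).+1.
have n0 : 0 < n%:R :> R by rewrite ltr0n.
have cn : `|c| / n%:R <= e.
  by rewrite ler_pdivrMr// mulrC -ler_pdivrMr// ltW// truncnS_gt.
have nc : n%:R * (n%:R^-1 * c) = c by rewrite mulrA divff ?mul1r ?gt_eqF.
have tDn : tail_step D (n%:R^-1 * c).
  by apply: tail_step_scale => //; rewrite invr_ge0.
have [k [E [mE ED kE]]] := spread_copies n tDn mB BD tW.
rewrite scalerA nc => ->; apply: le_trans cn; apply: monetary_lipschitz => w.
rewrite flatE !LinftyD !LinftyZ !indE//.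
rewrite opprD addrACA subrr addr0.
(* The mass balance [kE] divided by n P(D). *)
have BE : prob P B / prob P D = (k%:R + prob P E / prob P D) / n%:R.
  apply: (mulIf (lt0r_neq0 n0)); rewrite divfK ?gt_eqF//.
  apply: (mulIf (lt0r_neq0 D0)); rewrite mulrAC divfK ?gt_eqF//.
  rewrite mulrDl divfK ?gt_eqF//.
  by rewrite kE mulrC.
have [/set_mem wD|/negP wD] := boolP (w \in D); last first.
  have wE : (w \in E) = false by apply/negP => /set_mem/ED/mem_set.
  by rewrite wE !mulr0 addr0 subrr normr0 divr_ge0.
rewrite !mulr1; have -> : k%:R * (n%:R^-1 * c) + n%:R^-1 * c * (w \in E)%:R
    - prob P B / prob P D * c = ((w \in E)%:R - prob P E / prob P D) * (c / n%:R).
  by rewrite BE; field; rewrite !gt_eqF.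
rewrite normrM normf_div [`|n%:R|]gtr0_norm// ler_piMl// ?divr_ge0//.
have ED1 : prob P E / prob P D <= 1 by rewrite ler_pdivrMr// mul1r le_prob.
have ED0 : 0 <= prob P E / prob P D by rewrite divr_ge0 ?prob_ge0.
by rewrite ler_norml; case: (w \in E) => /=; apply/andP; split; lra.
Qed.

Lemma flattens_sum D (F : nat -> Linfty P) n : measurable D ->
  (forall i, flattens D (F i)) -> flattens D (\sum_(i < n) F i).
Proof.
move=> mD fF; elim: n => [|n IH]; last by rewrite big_ord_recr; exact: flattensD.
rewrite big_ord0; have t0 : tail_on A (0 : Linfty P) by exists 0; split.
have flat0 : flat D 0 = 0.
  by rewrite /flat -(scale0r (0 : Linfty P)) pmeanZ// mul0r mul0r !scale0r.
by rewrite /flattens flat0.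
Qed.

End Averaging.

(** * Approximation by level sets and reduction to two values *)

Section Levels.
Context (d : measure_display) (T : measurableType d) (R : realType).
Variable P : probability T R.
Implicit Types (X Y W V : Linfty P) (A B D : set T).

(** The sum counts the integers between 1 and y, so it is the integer part of y. *)
Lemma sum_levels (y : R) n : 0 <= y <= n%:R ->
  y - 1 <= \sum_(i < n) (i.+1%:R <= y)%R%:R <= y.
Proof.
have full m : m%:R <= y -> \sum_(i < m) (i.+1%:R <= y)%R%:R = m%:R :> R.
  move=> my; rewrite (eq_bigr (fun=> 1)); first by rewrite sumr_const card_ord.
  by move=> i _; rewrite (le_trans _ my)// ler_nat.
elim: n => [|n IH] /andP[y0 yn]; first by rewrite big_ord0; lra.
rewrite big_ord_recr/=; have [ny|yn1] := leP n.+1%:R y.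
  rewrite full; last by rewrite (le_trans _ ny)// ler_nat.
  by rewrite -natr1 in ny yn; rewrite /= mulr1n; lra.
rewrite addr0; have [ny|yn2] := leP n%:R y.
  by rewrite full//; rewrite -natr1 in yn1; lra.
by apply: IH; rewrite y0 ltW.
Qed.

(** Where 0 <= Y <= n on D, this is c times the integer part of Y, written as a sum of steps to
    which [flattens_ind] applies. *)
Definition levels (c : R) D Y n :=
  \sum_(i < n) c *: ind P (D `&` [set w | i.+1%:R <= Y w]).

Lemma measurable_level D Y (i : nat) : measurable D ->
  measurable (D `&` [set w | i.+1%:R <= Y w]).
Proof. by move=> mD; apply: measurableI => //; exact: measurable_ge. Qed.

Lemma levels_in c D Y n w : measurable D -> D w -> 0 <= Y w <= n%:R ->
  `|c * Y w - levels c D Y n w| <= `|c|.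
Proof.
move=> mD Dw /sum_levels /andP[lo hi].
rewrite /levels
  (@Linfty_sum _ _ _ _ (fun i => c *: ind P (D `&` [set w | i.+1%:R <= Y w]))).
have -> : \sum_(i < n) (c *: ind P (D `&` [set w | i.+1%:R <= Y w])) w =
    c * \sum_(i < n) (i.+1%:R <= Y w)%R%:R.
  rewrite mulr_sumr; apply: eq_bigr => i _.
  rewrite LinftyZ indE; last exact: measurable_level.
  congr (_ * (_ : bool)%:R).
  by apply/idP/idP => [/set_mem[]//|h]; exact/mem_set.
rewrite -mulrBr normrM ler_piMr// ler_norml; lra.
Qed.

Lemma levels_out c D Y n w : measurable D -> ~ D w -> levels c D Y n w = 0.
Proof.
move=> mD Dw; rewrite /levels.
rewrite (@Linfty_sum _ _ _ _ (fun i => c *: ind P (D `&` [set w | i.+1%:R <= Y w]))).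
apply: big1 => i _; rewrite LinftyZ indE; last exact: measurable_level.
by rewrite memNset ?mulr0// => -[].
Qed.

Lemma pmean_dist D V W e : measurable D -> 0 < prob P D ->
  (forall w, D w -> `|V w - W w| <= e) ->
  `|pmean D V / prob P D - pmean D W / prob P D| <= e.
Proof.
move=> mD D0 VW.
have half V' W' : (forall w, D w -> `|V' w - W' w| <= e) ->
    pmean D V' / prob P D - pmean D W' / prob P D <= e.
  move=> VW'; rewrite -mulrBl ler_pdivrMr// lerBlDr -pmean_cst// -pmeanD//.
  apply: pmean_le => // w Dw; rewrite LinftyD /=.
  by have := VW' w Dw; rewrite ler_norml; lra.
rewrite ler_norml lerNl opprB !half//.
by move=> w Dw; rewrite distrC VW.
Qed.

End Levels.

Section Reduction.
Context (d : measure_display) (T : measurableType d) (R : realType).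
Variables (P : probability T R) (p : R) (rho : Linfty P -> R).
Hypotheses (P_atomless : atomless P) (p_gt0 : 0 < p) (p_lt1 : p < 1).
Hypotheses (rho_pCA : pCA p rho) (rho_mon : monetary rho).
Implicit Types (X Y W V : Linfty P) (A B D : set T).

Lemma flattens_levels A D c Y n : measurable A -> prob P A = 1 - p ->
  tail_step P A D c -> flattens rho A D (levels c D Y n).
Proof.
move=> mA Ap tDc; have [mD _ _] := tDc.
apply: (flattens_sum
  (F := fun i => c *: ind P (D `&` [set w | i.+1%:R <= Y w]))) => // i.
apply: (flattens_ind P_atomless p_gt0 p_lt1 rho_pCA rho_mon mA Ap tDc) => //.
exact: measurable_level.
Qed.

(** Round X - q towards 0 to multiples of 1/n: the result is a sum U of upward steps inside A and a
    sum L of downward steps outside A, both of which can be averaged. *)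
Lemma flatten_bounded X A q (K : R) : measurable A -> prob P A = 1 - p ->
  separates A q X -> (forall w, `|X w - q| <= K) ->
  rho X = rho (flat A X + flat (~` A) X).
Proof.
move=> mA Ap [Aq qA] XK; have mAC : measurable (~` A) by exact: measurableC.
have A0 : 0 < prob P A by rewrite Ap subr_gt0.
have AC0 : 0 < prob P (~` A) by rewrite probC// Ap opprB addrC subrK.
apply/eqP; rewrite -subr_eq0 -normr_le0; apply/ler_addgt0Pr => e e0.
(* One error 1/n comes from rounding X, the other from comparing the conditional means of X and of
   its rounding. *)
rewrite add0r; pose n := (Num.truncn (2 / e)).+1.
have n0 : 0 < n%:R :> R by rewrite ltr0n.
have ne : n%:R^-1 + n%:R^-1 <= e.
  have : 2 / e <= n%:R by rewrite ltW// truncnS_gt.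
  rewrite ler_pdivrMr// -ler_pdivrMl// mulrC => h; lra.
pose m := (Num.truncn (n%:R * K)).+1.
have nm : n%:R * K <= m%:R by rewrite ltW// truncnS_gt.
pose Yu := n%:R *: (X - cstL P q); pose Yd := n%:R *: (cstL P q - X).
have YuE w : Yu w = n%:R * (X w - q) by [].
have YdE w : Yd w = n%:R * (q - X w) by [].
have Yum w : A w -> 0 <= Yu w <= m%:R.
  move=> Aw; rewrite YuE mulr_ge0 ?subr_ge0 ?Aq//= (le_trans _ nm)//.
  by rewrite ler_pM2l//; have := XK w; rewrite ler_norml => /andP[].
have Ydm w : ~ A w -> 0 <= Yd w <= m%:R.
  move=> Aw; rewrite YdE mulr_ge0 ?subr_ge0 ?qA//= (le_trans _ nm)//.
  by rewrite ler_pM2l//; have := XK w; rewrite distrC ler_norml => /andP[].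
pose U := levels n%:R^-1 A Yu m; pose L := levels (- n%:R^-1) (~` A) Yd m.
have UE w : A w -> `|(X w - q) - U w| <= n%:R^-1.
  move=> Aw; have := levels_in n%:R^-1 mA Aw (Yum w Aw).
  by rewrite YuE mulKf ?gt_eqF// [X in _ <= X]gtr0_norm// invr_gt0.
have LE w : ~ A w -> `|(X w - q) - L w| <= n%:R^-1.
  move=> Aw; have := levels_in (- n%:R^-1) mAC Aw (Ydm w Aw).
  by rewrite YdE mulNr mulKf ?gt_eqF// opprB normrN
    [X in _ <= X]gtr0_norm// invr_gt0.
have Xn : `|rho X - rho (U + (L + cstL P q))| <= n%:R^-1.
  apply: monetary_lipschitz => // w; rewrite !LinftyD /=.
  have [Aw|Aw] := pselect (A w).
    by rewrite [L w]levels_out// add0r opprD addrA addrAC UE.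
  by rewrite [U w]levels_out// add0r opprD addrA addrAC LE.
have fU : flattens rho A A U.
  apply: flattens_levels => //; split => // B mB BA.
  by apply: ge0_tail_on_ind => //; rewrite invr_ge0.
have fL : flattens rho A (~` A) L.
  apply: flattens_levels => //; split => // B mB BA.
  by apply: le0_tail_on_ind => //; rewrite oppr_le0 invr_ge0.
have [tU tfU {}fU] := fU; have [tL tfL {}fL] := fL.
have tq := tail_on_cst P A q.
(* U is averaged against L + q, then L against the averaged U plus q, which is still in the cone. *)
have rhoE : rho (U + (L + cstL P q)) = rho (flat A U + flat (~` A) L + cstL P q).
  rewrite fU; last exact: tail_onD.
  by rewrite addrCA fL 1?addrCA ?addrA//; exact: tail_onD.
apply: le_trans ne; rewrite rhoE in Xn.
rewrite (le_trans (ler_distD (rho (flat A U + flat (~` A) L + cstL P q)) _ _))//.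
apply: lerD => //; apply: monetary_lipschitz => // w.
rewrite !LinftyD !LinftyZ !indE//.
have shift D : 0 < prob P D -> measurable D ->
    pmean D (X - cstL P q) / prob P D = pmean D X / prob P D - q.
  move=> D0 mD; rewrite -scaleN1r pmeanD// pmeanZ// pmean_cst//.
  by field; rewrite gt_eqF.
have dist D V : 0 < prob P D -> measurable D ->
    (forall w, D w -> `|(X w - q) - V w| <= n%:R^-1) ->
    `|pmean D V / prob P D + q - pmean D X / prob P D| <= n%:R^-1.
  move=> D0 mD XV; rewrite -addrA -opprB -(shift D D0 mD); apply: pmean_dist => //.
  by move=> w' Dw'; rewrite distrC XV.
rewrite in_setC; have [/set_mem Aw|/negP Aw] := boolP (w \in A);
  by rewrite /= !mulr0 !mulr1 ?addr0 ?add0r dist.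
Qed.

End Reduction.

(** * Order and convexity properties of ES and of mean-ES functionals *)

Lemma convex_funP (R : realType) (D : set R) (g : R -> R) : convex_function D g <->
  forall t x y, 0 <= t -> t <= 1 -> D x -> D y ->
    g (t * x + (1 - t) * y) <= t * g x + (1 - t) * g y.
Proof.
split=> [cg t x y t0 t1 Dx Dy|cg t x y /set_mem Dx /set_mem Dy].
  exact: (cg (Itv01 t0 t1) _ _ (mem_set Dx) (mem_set Dy)).
exact: cg.
Qed.

Section MeanES.
Context (d : measure_display) (T : measurableType d) (R : realType).
Variables (P : probability T R) (p : R).
Hypotheses (P_atomless : atomless P) (p_gt0 : 0 < p) (p_lt1 : p < 1).
Implicit Types (X Y W V : Linfty P) (A B D : set T).

Let p1_gt0 : 0 < 1 - p. Proof. by rewrite subr_gt0. Qed.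

Lemma ES_le X Y : (forall w, X w <= Y w) -> ES p X <= ES p Y.
Proof.
move=> XY; have [A [q [mA Ap sep]]] := separating_set X P_atomless p_gt0 p_lt1.
rewrite -(ler_pM2l p1_gt0) (ES_separates p_gt0 p_lt1 mA Ap sep).
apply: le_trans (ES_ge p_gt0 p_lt1 Y P_atomless mA Ap).
exact: pmean_le.
Qed.

(** On a tail event of X + Y the mean splits, and each term is bounded by the maximum in [ES_ge]. *)
Lemma ESD_le X Y : ES p (X + Y) <= ES p X + ES p Y.
Proof.
have [A [q [mA Ap sep]]] := separating_set (X + Y) P_atomless p_gt0 p_lt1.
rewrite -(ler_pM2l p1_gt0) (ES_separates p_gt0 p_lt1 mA Ap sep) mulrDr pmeanD//.
by rewrite lerD// (ES_ge p_gt0 p_lt1).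
Qed.

Lemma ESZ a X : 0 <= a -> ES p (a *: X) = a * ES p X.
Proof.
move=> a0; have [A [q [mA Ap [Aq qA]]]] := separating_set X P_atomless p_gt0 p_lt1.
apply: (mulfI (lt0r_neq0 p1_gt0)).
rewrite [RHS]mulrCA (ES_separates p_gt0 p_lt1 mA Ap (conj Aq qA)) -pmeanZ//.
apply: (@ES_separates _ _ _ _ _ p_gt0 p_lt1 A (a * q)) => //.
split => w Aw; rewrite LinftyZ ler_wpM2l//.
  exact: Aq.
exact: qA.
Qed.

Lemma ES_translate X c : ES p (X + cstL P c) = ES p X + c.
Proof.
have [A [q [mA Ap [Aq qA]]]] := separating_set X P_atomless p_gt0 p_lt1.
apply: (mulfI (lt0r_neq0 p1_gt0)).
rewrite mulrDr (ES_separates p_gt0 p_lt1 mA Ap (conj Aq qA)).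
have -> : (1 - p) * c = pmean A (cstL P c) by rewrite pmean_cst// Ap mulrC.
rewrite -pmeanD//.
apply: (@ES_separates _ _ _ _ _ p_gt0 p_lt1 A (q + c)) => //.
split => w Aw; rewrite LinftyD lerD2r.
  exact: Aq.
exact: qA.
Qed.

(** The mean is the weighted average of ES, which is at least q, and of the conditional mean off A,
    which is at most q. *)
Lemma mean_le_ES X : mean X <= ES p X.
Proof.
have [A [q [mA Ap [Aq qA]]]] := separating_set X P_atomless p_gt0 p_lt1.
have mAC : measurable (~` A) by exact: measurableC.
have ESE := ES_separates p_gt0 p_lt1 mA Ap (conj Aq qA).
have lo : q * prob P A <= pmean A X.
  by rewrite -pmean_cst//; apply: pmean_le => //; exact: Aq.
have hi : pmean (~` A) X <= q * prob P (~` A).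
  by rewrite -pmean_cst//; apply: pmean_le => //; exact: qA.
rewrite (pmeanC X mA) -ESE; rewrite probC// Ap in hi; rewrite Ap -ESE in lo.
have qES : q <= ES p X by rewrite -(ler_pM2l p1_gt0) mulrC.
have : q * p <= ES p X * p by rewrite ler_pM2r.
rewrite opprB addrCA subrr addr0 in hi; lra.
Qed.

Lemma mean_le X Y : (forall w, X w <= Y w) -> mean X <= mean Y.
Proof. by move=> XY; rewrite !meanE; apply: pmean_le. Qed.

Lemma meanD X Y : mean (X + Y) = mean X + mean Y.
Proof. by rewrite !meanE pmeanD. Qed.

Lemma meanZ a X : mean (a *: X) = a * mean X.
Proof. by rewrite !meanE pmeanZ. Qed.

Lemma mean_cst c : mean (cstL P c) = c.
Proof. by rewrite meanE pmean_cst// probT mulr1. Qed.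

Lemma icx_mean X Y :
  (forall u : R -> R, {homo u : x y / x <= y} ->
    convex_function (setT : set R) u -> ('E_P[u \o X] <= 'E_P[u \o Y])%E) ->
  mean X <= mean Y.
Proof.
move=> XY; rewrite /mean fine_le//.
- by rewrite unlock integrable_fin_num//; exact: integrable_Linfty.
- by rewrite unlock integrable_fin_num//; exact: integrable_Linfty.
- by apply: (XY id) => // t x y.
Qed.

(** The threshold q of Y makes the excess formula exact for Y and an upper bound for X; then test
    the order with (x - q)^+. *)
Lemma icx_ES X Y :
  (forall u : R -> R, {homo u : x y / x <= y} ->
    convex_function (setT : set R) u -> ('E_P[u \o X] <= 'E_P[u \o Y])%E) ->
  ES p X <= ES p Y.
Proof.
move=> XY; have [A [q [mA Ap sep]]] := separating_set Y P_atomless p_gt0 p_lt1.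
rewrite -(ler_pM2l p1_gt0) (ES_separates p_gt0 p_lt1 mA Ap sep).
apply: le_trans (ES_le_excess p_gt0 p_lt1 X q P_atomless) _.
rewrite (pmean_separates mA sep) Ap lerD2l.
pose u x : R := Num.max (x - q) 0.
have /XY : {homo u : x y / x <= y}.
  by move=> x y xy; rewrite /u ge_max !le_max lexx orbT lerB.
have u_convex : convex_function (setT : set R) u.
  apply/convex_funP => t x y t0 t1 _ _; rewrite /u ge_max.
  have t1' : 0 <= 1 - t by rewrite subr_ge0.
  apply/andP; split; last by rewrite addr_ge0// mulr_ge0// le_max lexx orbT.
  have -> : t * x + (1 - t) * y - q = t * (x - q) + (1 - t) * (y - q) by ring.
  by rewrite lerD// ler_wpM2l// le_max lexx.
by move=> /(_ u_convex) le_u; rewrite /excess /Rintegral fine_le//;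
  [exact: (integrable_fin_num measurableT (integrable_excess _ q measurableT))
  |exact: (integrable_fin_num measurableT (integrable_excess _ q measurableT))
  |by rewrite unlock in le_u].
Qed.

Variables (g : R -> R) (rho : Linfty P -> R).
Hypotheses (g_inc : increasing_nonneg g) (g_lip : lipschitz1_nonneg g).
Hypothesis rhoE : forall X, rho X = g (ES p X - mean X) + mean X.

(** If ES - E grows, g increasing suffices. If it drops, the Lipschitz bound limits the loss in g to
    that drop, so [rho] gains at least ES(Y) - ES(X). *)
Lemma meanES_le X Y : mean X <= mean Y -> ES p X <= ES p Y -> rho X <= rho Y.
Proof.
move=> mXY eXY; rewrite !rhoE.
have X0 : 0 <= ES p X - mean X by rewrite subr_ge0 mean_le_ES.
have Y0 : 0 <= ES p Y - mean Y by rewrite subr_ge0 mean_le_ES.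
have [XY|YX] := leP (ES p X - mean X) (ES p Y - mean Y).
  by have := g_inc X0 XY; lra.
have := g_lip X0 Y0; rewrite [X in _ <= X]gtr0_norm ?subr_gt0//.
by rewrite ler_norml => /andP[_]; lra.
Qed.

Lemma meanES_monetary : monetary rho.
Proof.
split => [X Y XY|X c]; first by apply: meanES_le; [exact: mean_le|exact: ES_le].
rewrite !rhoE ES_translate meanD mean_cst.
have -> : ES p X + c - (mean X + c) = ES p X - mean X by ring.
by rewrite addrA.
Qed.

Lemma meanES_consistent : consistent rho.
Proof.
split=> [|X Y XY]; first exact: meanES_monetary.
by apply: meanES_le; [exact: icx_mean|exact: icx_ES].
Qed.

Lemma meanES_convex : convex_function (`[0, +oo[%classic : set R) g ->
  convex_risk rho.
Proof.
move=> g_conv; split => [|X Y l l0 l1]; first exact: meanES_monetary.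
have l1' : 0 <= 1 - l by rewrite subr_ge0.
pose D X := ES p X - mean X.
have D0 X' : 0 <= D X' by rewrite subr_ge0 mean_le_ES.
have conv : g (l * D X + (1 - l) * D Y) <= l * g (D X) + (1 - l) * g (D Y).
  by move/convex_funP : g_conv; apply => //; rewrite /= in_itv/= andbT; exact: D0.
have sub : D (l *: X + (1 - l) *: Y) <= l * D X + (1 - l) * D Y.
  rewrite /D meanD !meanZ; have := ESD_le (l *: X) ((1 - l) *: Y).
  rewrite !ESZ//; lra.
rewrite !rhoE -/(D _) -/(D X) -/(D Y) meanD !meanZ.
have := g_inc (D0 _) sub; lra.
Qed.

End MeanES.

(** * The mean-ES representation *)

Section Representation.
Context (d : measure_display) (T : measurableType d) (R : realType).
Variables (P : probability T R) (p : R) (rho : Linfty P -> R).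
Hypotheses (P_atomless : atomless P) (p_gt0 : 0 < p) (p_lt1 : p < 1).
Hypotheses (rho_pCA : pCA p rho) (rho_mon : monetary rho) (rho0 : rho 0 = 0).
Implicit Types (X Y W V : Linfty P) (A B D : set T).

Variable A : set T.
Hypotheses (mA : measurable A) (Ap : prob P A = 1 - p).

(** For x >= 0 the variable (x/p) 1_A has ES x/p and mean (1-p)x/p, so that ES - E = x: any
    representing g must take this value. *)
Definition profile (x : R) : R := rho ((x / p) *: ind P A) - (1 - p) / p * x.

Lemma rho_profile X : rho X = profile (ES p X - mean X) + mean X.
Proof.
have [Y [M [YM XY]]] := Linfty_truncation X.
have lawXY := ae_eq_in_law XY.
rewrite (law_invariant P_atomless p_gt0 p_lt1 rho_pCA lawXY) (eq_in_law_ES p lawXY).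
have -> : mean X = mean Y by rewrite !meanE; exact: ae_eq_pmean.
have [B [q [mB Bp sep]]] := separating_set Y P_atomless p_gt0 p_lt1.
have YK w : `|Y w - q| <= M + `|q| by rewrite (le_trans (ler_normB _ _))// lerD2r.
rewrite (flatten_bounded P_atomless p_gt0 p_lt1 rho_pCA rho_mon mB Bp sep YK).
set a := ES p Y; set m := mean Y.
have pB : pmean B Y = (1 - p) * a by rewrite -(ES_separates p_gt0 p_lt1 mB Bp sep).
have pBC : pmean (~` B) Y = m - (1 - p) * a by rewrite /m (pmeanC Y mB) pB; ring.
have p0 : p != 0 by rewrite gt_eqF.
have p1 : 1 - p != 0 by rewrite gt_eqF// subr_gt0.
(* The averaged variable equals a on B and b = (m - (1-p)a)/p off B, with a - b = (a-m)/p. *)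
have -> : flat B Y + flat (~` B) Y =
    ((a - m) / p) *: ind P B + cstL P ((m - (1 - p) * a) / p).
  apply/LfuneqP => w; rewrite !LinftyD !LinftyZ pB pBC probC// Bp.
  rewrite !indE//; last exact: measurableC.
  rewrite /= in_setC; case: (w \in B); rewrite /= ?mulr1 ?mulr0.
    by field; rewrite p0 p1.
  by field.
have [_ ->] := rho_mon.
rewrite /profile.
have /(law_invariant P_atomless p_gt0 p_lt1 rho_pCA) -> :
    eq_in_law (((a - m) / p) *: ind P B) (((a - m) / p) *: ind P A).
  by apply: eq_in_law_ind => //; rewrite Bp Ap.
by rewrite -addrA; congr (_ + _); field.
Qed.

Lemma profile0 : profile 0 = 0.
Proof. by rewrite /profile mul0r scale0r rho0 mulr0 subr0. Qed.

(** Monotonicity of [rho] gives this weak bound, which serves to compare with the value at 0, out of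
    reach of repeated halving. *)
Lemma profile_ge x y : 0 <= x -> x <= y ->
  profile x - (1 - p) / p * (y - x) <= profile y.
Proof.
move=> x0 xy; have : rho ((x / p) *: ind P A) <= rho ((y / p) *: ind P A).
  have [mono _] := rho_mon; apply: mono => w; rewrite !LinftyZ indE//.
  by rewrite ler_wpM2r// ler_pM2r// invr_gt0.
by rewrite /profile; lra.
Qed.

(** The uniform Lipschitz bound gives slope 1/p, and the linear correction removes (1-p)/p of it. *)
Lemma profile_le x y : x <= y -> profile y <= profile x + (y - x).
Proof.
move=> xy.
have : `|rho ((y / p) *: ind P A) - rho ((x / p) *: ind P A)| <= (y - x) / p.
  apply: (monetary_lipschitz rho_mon) => w; rewrite !LinftyZ indE// -mulrBl -mulrBl.
  have yx0 : 0 <= (y - x) / p by rewrite divr_ge0 ?subr_ge0// ltW.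
  by rewrite normrM (ger0_norm yx0) ler_piMr// ger0_norm// lern1 leq_b1.
rewrite ler_norml /profile => /andP[_].
have -> : (y - x) / p = (y - x) + (1 - p) / p * y - (1 - p) / p * x.
  by field; rewrite gt_eqF.
lra.
Qed.

(* Replacing one of the two comonotone indicators by that of an event B
   independent of A lowers ES - E from x to x'. *)
Lemma profile_half x x' : 0 <= x' -> x' <= x -> x <= 2 * x' ->
  profile x' <= profile x.
Proof.
move=> x'0 x'x x2x'; have p0 : p != 0 by rewrite gt_eqF.
have mAC : measurable (~` A) by exact: measurableC.
have pp : 0 <= p * (1 - p) by rewrite mulr_ge0 ?ltW// subr_gt0.
have qq : 0 <= (1 - p) * (1 - p) by rewrite mulr_ge0// subr_ge0 ltW.
(* B1 and B2 are the parts of B inside and outside A, with the masses that independence from A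
   requires. *)
have [|B1 [mB1 B1A B1p]] := @sierpinski _ _ _ P P_atomless A ((1 - p) * (1 - p)) mA.
  by rewrite Ap; apply/andP; split; lra.
have p2 : 0 <= p * p by rewrite mulr_ge0 ?ltW.
have [|B2 [mB2 B2A B2p]] := @sierpinski _ _ _ P P_atomless (~` A) (p * (1 - p)) mAC.
  by rewrite probC// Ap; apply/andP; split; lra.
have B12 : B1 `&` B2 = set0 by rewrite -subset0 => w [/B1A Aw /B2A].
have mB : measurable (B1 `|` B2) by exact: measurableU.
have Bp : prob P (B1 `|` B2) = prob P A by rewrite probU// B1p B2p Ap; ring.
(* Here c + e = x/p, and c 1_A + e 1_B has ES c + e(1-p) and mean (c+e)(1-p), with difference cp =
   x'. *)
pose c := x' / p; pose e := (x - x') / p.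
have c0 : 0 <= c by rewrite divr_ge0// ltW.
have e0 : 0 <= e by rewrite divr_ge0// ?subr_ge0// ltW.
(* This is where x <= 2x' enters: the sum is at most e off A and at least c on A, so A remains a
   tail event. *)
have ec : e <= c by rewrite ler_pM2r ?invr_gt0//; lra.
have tcA k : 0 <= k -> tail_on A (k *: ind P A).
  by move=> k0; exact: ge0_tail_on_ind.
have le_rho : rho (c *: ind P A + e *: ind P (B1 `|` B2)) <=
    rho ((x / p) *: ind P A).
  have -> : (x / p) *: ind P A = c *: ind P A + e *: ind P A.
    by rewrite -scalerDl; congr (_ *: _); rewrite /c /e; ring.
  apply: rho_pCA => //; last by apply: eq_in_law_ind.
  by exists A; split; apply: tail_on_p_tail_event => //; exact: tcA.
set X := c *: ind P A + e *: ind P (B1 `|` B2) in le_rho.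
have sepX : separates A c X.
  split => w Aw; rewrite /X LinftyD !LinftyZ !indE//.
    by rewrite mem_set// mulr1 lerDl mulr_ge0.
  rewrite memNset// mulr0 add0r (le_trans _ ec)// ler_piMr//.
  by rewrite lern1 leq_b1.
have mX : mean X = x / p * (1 - p).
  rewrite meanE /X pmeanD// !pmeanZ// !pmean_ind// Bp Ap /c /e.
  by ring.
have EX : ES p X = c + e * (1 - p).
  have p1 : 1 - p != 0 by rewrite gt_eqF// subr_gt0.
  apply: (mulfI p1); rewrite (ES_separates p_gt0 p_lt1 mA Ap sepX).
  have B2A0 : pmean A (ind P B2) = 0.
    have := pmeanC (ind P B2) mA; rewrite meanE.
    by rewrite (pmean_ind P measurableT mB2 (@subsetT _ _))
      (pmean_ind P mAC mB2 B2A); lra.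
  by rewrite /X indU// pmeanD// !pmeanZ// pmeanD// B2A0 !pmean_ind// Ap B1p; ring.
have DX : ES p X - mean X = x' by rewrite EX mX /c /e; field.
have := rho_profile X; rewrite DX mX => XE; rewrite XE in le_rho.
rewrite /profile in le_rho *.
have -> : (1 - p) / p * x = x / p * (1 - p) by ring.
by rewrite -lerBrDr in le_rho.
Qed.

Lemma profile_increasing : increasing_nonneg profile.
Proof.
have iter n : forall x x', 0 <= x' -> x' <= x -> x <= 2 ^+ n * x' ->
    profile x' <= profile x.
  elim: n => [|n IH] x x' x'0 x'x.
    by rewrite expr0 mul1r => xx'; have -> : x = x' by lra.
  rewrite exprS => xn; have [x2|x2] := leP x (2 * x'); first exact: profile_half.
  apply: (@le_trans _ _ (profile (x / 2))); last by apply: profile_half; lra.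
  by apply: IH => //; lra.
have pos x x' : 0 < x' -> x' <= x -> profile x' <= profile x.
  move=> x'0 x'x; apply: (iter (Num.truncn (x / x')).+1) => //; first exact: ltW.
  rewrite -ler_pdivrMr// (le_trans (ltW (truncnS_gt _)))// -natrX ler_nat.
  exact/ltnW/ltn_expl.
move=> x' x; rewrite le_eqVlt => /predU1P[<-|]; last exact: pos.
move=> x0; rewrite profile0 leNgt; apply/negP => gx.
have xp : 0 < x.
  rewrite lt_neqAle x0 andbT; apply/eqP => x00.
  by rewrite -x00 profile0 ltxx in gx.
(* If the profile were negative at x, [profile_ge] would give it at this small e a value above half
   of that at x, against monotonicity on positive arguments. *)
pose e := Num.min x (- profile x / 2 * p).
have e0 : 0 < e by rewrite lt_min xp/= mulr_gt0// divr_gt0// oppr_gt0.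
have ex : e <= x by rewrite ge_min lexx.
have ep : e / p <= - profile x / 2 by rewrite ler_pdivrMr// ge_min lexx orbT.
have := pos x e e0 ex; have := profile_ge (lexx 0) (ltW e0).
rewrite profile0 subr0 sub0r.
have -> : (1 - p) / p * e = e / p - e by field; rewrite gt_eqF.
lra.
Qed.

Lemma profile_lipschitz : lipschitz1_nonneg profile.
Proof.
have half x y : 0 <= x -> x <= y -> `|profile y - profile x| <= y - x.
  move=> x0 xy; rewrite ger0_norm ?subr_ge0 ?profile_increasing//.
  by rewrite lerBlDl profile_le.
move=> x y x0 y0; have [xy|/ltW yx] := leP x y.
  by rewrite distrC [leRHS]distrC [leRHS]ger0_norm ?subr_ge0// half.
by rewrite [leRHS]ger0_norm ?subr_ge0// half.
Qed.

Lemma profile_convex : convex_risk rho ->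
  convex_function (`[0, +oo[%classic : set R) profile.
Proof.
move=> [_ cvx]; apply/convex_funP => t x y t0 t1 _ _; rewrite /profile.
have := cvx ((x / p) *: ind P A) ((y / p) *: ind P A) t t0 t1.
have -> : t *: ((x / p) *: ind P A) + (1 - t) *: ((y / p) *: ind P A) =
    ((t * x + (1 - t) * y) / p) *: ind P A.
  by rewrite !scalerA -scalerDl; congr (_ *: _); ring.
lra.
Qed.

Lemma profile_homogeneous : coherent rho ->
  forall x, 0 <= x -> profile x = profile 1 * x.
Proof.
move=> [_ hom] x; rewrite le_eqVlt => /predU1P[<-|x0].
  by rewrite profile0 mulr0.
rewrite /profile; have -> : (x / p) *: ind P A = x *: ((1 / p) *: ind P A).
  by rewrite scalerA mul1r.
rewrite (hom _ _ x0). ring.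
Qed.

End Representation.

Theorem proposition2 (d : measure_display) (T : measurableType d)
  (R : realType) (P : probability T R) (p : R) (rho : Linfty P -> R)
  (P_atomless : atomless P) (p_gt0 : 0 < p) (p_lt1 : p < 1)
  (rho_pCA : pCA p rho) (rho0 : rho 0 = 0) :
  [/\ consistent rho <->
        (exists g : R -> R,
          [/\ increasing_nonneg g, lipschitz1_nonneg g, g 0 = 0 &
            forall X : Linfty P, rho X = g (ES p X - mean X) + mean X]),
      convex_risk rho <->
        (exists g : R -> R,
          [/\ increasing_nonneg g,
              convex_function (`[0, +oo[%classic : set R) g,
              lipschitz1_nonneg g, g 0 = 0 &
            forall X : Linfty P, rho X = g (ES p X - mean X) + mean X]) &
      coherent rho <->
        (exists alpha : R,
          [/\ 0 <= alpha, alpha <= 1 &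
            forall X : Linfty P,
              rho X = alpha * ES p X + (1 - alpha) * mean X])].
Proof.
(* Only an event of probability 1 - p is wanted here. *)
have [A [q [mA Ap _]]] := separating_set (0 : Linfty P) P_atomless p_gt0 p_lt1.
have rep mon X := rho_profile P_atomless p_gt0 p_lt1 rho_pCA mon mA Ap X.
have inc mon := profile_increasing P_atomless p_gt0 p_lt1 rho_pCA mon rho0 mA Ap.
have lip mon := profile_lipschitz P_atomless p_gt0 p_lt1 rho_pCA mon rho0 mA Ap.
have g0 := profile0 p rho0 A.
split; split.
- move=> [mon _]; exists (profile p rho A).
  by split; [exact: inc|exact: lip|exact: g0|exact: rep].
- move=> [g [g_inc g_lip _ rhoE]].
  exact: (meanES_consistent P_atomless p_gt0 p_lt1 g_inc g_lip rhoE).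
- move=> /[dup] cvx [mon _]; exists (profile p rho A).
  by split; [exact: inc|exact: profile_convex|exact: lip|exact: g0|exact: rep].
- move=> [g [g_inc g_cvx g_lip _ rhoE]].
  exact: (meanES_convex P_atomless p_gt0 p_lt1 g_inc g_lip rhoE).
(* By homogeneity the profile is linear with slope its value at 1, which lies in [0, 1] because the
   profile is increasing and 1-Lipschitz. *)
- move=> /[dup] coh [[mon _] _]; exists (profile p rho A 1); split.
  + by rewrite -g0; apply: inc.
  + have := lip mon 1 0 ler01 (lexx 0); rewrite g0 !subr0 normr1.
    exact: le_trans (ler_norm _).
  + move=> X; rewrite rep// (profile_homogeneous p rho0 A coh); first ring.
    by rewrite subr_ge0 mean_le_ES.
move=> [alpha [alpha0 alpha1 rhoE]].
have rhoE' X : rho X = alpha * (ES p X - mean X) + mean X by rewrite rhoE; ring.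
split.
  apply: (@meanES_convex _ _ _ _ _ P_atomless p_gt0 p_lt1 ( *%R alpha)) => //.
  - by move=> x y x0 xy; rewrite ler_wpM2l.
  - by move=> x y x0 y0; rewrite -mulrBr normrM (ger0_norm alpha0) ler_piMl.
  - by apply/convex_funP => t x y _ _ _ _; lra.
by move=> X l l0; rewrite !rhoE meanZ ESZ ?ltW//; ring.
Qed.
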